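(* For each of the following pairs $(r,d)$ one has $det^{S^r}(E^{(r)}_d)\neq 0$: $r=2$ and $2\le d\le 10$; $r=3$ and $2\le d\le 10$; $r=4$ and $2\le d\le 9$; $r=5$ and $2\le d\le 5$; $r=6$ and $2\le d\le 3$; $r=7$ and $d=2$; $r=8$ and $d=2$. In particular, for those values $(r,d)$ the map $det^{S^r}$ is nontrivial, and so $\dim_k(\Lambda^{S^r}_{V_d}[rd])\geq 1$.
   Context: $k$ is a field of characteristic zero, $\otimes=\otimes_k$, and $V_d$ is a $k$-vector space of dimension $d$ with basis $\{e_1,\dots,e_d\}$. Definition of $det^{S^r}$ ($r\ge 2$). Given $v_{i_1,\dots,i_r}\in V_d$ for $1\leq i_1<\dots<i_r\leq rd$, for each $1\leq m_1<\dots<m_{r-1}\leq rd$ let $\mathcal{E}_{m_1,\dots,m_{r-1}}$ be the vector equation (with scalar unknowns $\lambda_{i_1,\dots,i_r}$) $$\sum_{j=0}^{r-1}\ \sum_{m_j<s<m_{j+1}}(-1)^{(s-1)+j}\lambda_{m_1,\dots,m_j,s,m_{j+1},\dots,m_{r-1}}\,v_{m_1,\dots,m_j,s,m_{j+1},\dots,m_{r-1}}=0,$$ where $m_0=0$ and $m_r=rd+1$. In the basis $e_1,\dots,e_d$ each such equation is a block of $d$ scalar linear equations. Let $A_{rd}((v_{i_1,\dots,i_r}))$ be the $d\binom{rd-1}{r-1}\times d\binom{rd-1}{r-1}$ coefficient matrix of the system of the equations $\mathcal{E}_{m_1,\dots,m_{r-1}}$ with $1\leq m_1<\dots<m_{r-1}<rd$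 (columns indexed by $(i_1,\dots,i_r)$, row blocks by $(m_1,\dots,m_{r-1})$, in lexicographic order). Then $det^{S^r}:V_d^{\otimes\binom{rd}{r}}\to k$ is the linear map with $det^{S^r}(\otimes(v_{i_1,\dots,i_r}))=\det(A_{rd}((v_{i_1,\dots,i_r})))$. Definition of $E^{(r)}_d$. For $1\leq a\leq d$ let ${\bf S}_a=\{ra-(r-1),ra-(r-2),\dots,ra\}$. For $1\le i_1<\dots<i_r\le rd$ let $a_q\in\{1,\dots,d\}$ be such that $i_q\in{\bf S}_{a_q}$ for $1\le q\le r$. Define $e_{i_1,\dots,i_r}=e_{a_t}$, where $t\in\{1,\dots,r\}$ is determined by $t-1\equiv\sum_{j=1}^r i_j\pmod r$. Then $E^{(r)}_d=\otimes_{1\leq i_1<\dots<i_r\leq rd}(e_{i_1,\dots,i_r})\in V_d^{\otimes\binom{rd}{r}}$. Definition of $\Lambda^{S^r}_{V_d}[n]$. It is the quotient of $V_d^{\otimes\binom{n}{r}}$ (factors indexed by $1\le i_1<\dots<i_r\le n$) by the subspace linearly generated by the simple tensors $\otimes(v_{i_1,\dots,i_r})$ for which there exist $1\leq x_1<\dots<x_{r+1}\leq n$ such that the $r+1$ vectors indexed by the $r$-element subsets of $\{x_1,\dots,x_{r+1}\}$ are all equal. *)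

(* Defs.v *)
From HB Require Import structures.
From mathcomp Require Import all_boot all_order all_algebra.
From mathcomp Require Import boolp.

Set Implicit Arguments.
Unset Strict Implicit.
Unset Printing Implicit Defensive.

Import Order.TTheory GRing.Theory.
Local Open Scope ring_scope.

(* The increasing sequences m <= i_1 < ... < i_r < m + n, in lexicographic    *)
(* order (lemmas mem_incseqs and incseqs_sorted).                             *)
Fixpoint incseqs (m n r : nat) : seq (seq nat) :=
  match n, r with
  | _, 0 => [:: [::]]
  | 0, _.+1 => [::]
  | n'.+1, r'.+1 => map (cons m) (incseqs m.+1 n' r') ++ incseqs m.+1 n' r
  end.

Lemma size_incseqs m n r : size (incseqs m n r) = 'C(n, r).
Proof.
elim: n m r => [|n IHn] m [|r] //=.
by rewrite size_cat size_map !IHn binS addnC.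
Qed.

Lemma mem_incseqs m n r s :
  (s \in incseqs m n r) =
  [&& size s == r, sorted ltn s & all (fun i => m <= i < m + n)%N s].
Proof.
elim: n m r s => [|n IHn] m [|r] s.
- by case: s.
- case: s => [|i s] //; rewrite in_nil /= addn0.
  have -> : (m <= i < m)%N = false.
    by apply/negP => /andP[le_mi]; rewrite ltnNge le_mi.
  by rewrite !andbF.
- by case: s.
rewrite [incseqs _ _ _]/= mem_cat IHn addSnnS.
have inj_cons : injective (cons m) by move=> ? ? [].
case: s => [|i s] /=.
  by rewrite orbF; apply/negbTE/mapP => -[].
rewrite eqSS !(path_sortedE ltn_trans).
case: (ltngtP m i) => [lt_mi|lt_im|<-{i}] /=.
- have -> : (i :: s \in [seq m :: i0 | i0 <- incseqs m.+1 n r]) = false.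
    by apply/mapP => -[t _ [eim]]; rewrite eim ltnn in lt_mi.
  rewrite /=; congr (_ && _); case: (boolP (all (ltn i) s)) => //= lt_is.
  congr (_ && (_ && _)); apply: eq_in_all => j /(allP lt_is) /= lt_ij.
  by rewrite (ltn_trans lt_mi lt_ij) (ltnW (ltn_trans lt_mi lt_ij)).
- rewrite !andbF orbF; apply/mapP => -[t _ [eim]].
  by rewrite eim ltnn in lt_im.
- rewrite !andbF orbF (mem_map inj_cons) IHn addSnnS.
  rewrite ?leqnn ?leq_addr ?addnS ?ltnS ?leq_addr /=.
  congr (_ && _); rewrite andbC -andbA [RHS]andbC -!andbA.
  rewrite -addnS; case: (sorted ltn s); rewrite ?andbF //= ?andbT.
  rewrite -all_predI; apply: eq_all => j /=.
  by case: (ltnP m j) => [/ltnW ->|]; rewrite ?andbT ?andbF.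
Qed.

Lemma incseqs_sorted m n r :
  sorted (fun s t : seqlexi nat => (s < t)%O) (incseqs m n r).
Proof.
rewrite (sorted_pairwise lt_trans).
elim: n m r => [|n IHn] m [|r] //=.
rewrite pairwise_cat IHn pairwise_map andbT; apply/andP; split.
  apply/allrelP => s t /mapP[s' _ ->]; rewrite mem_incseqs => /and3P[].
  case: t => // i t _ _ /= /andP[/andP[lt_mi _] _].
  by rewrite ltxi_cons !leEnat (ltnW lt_mi) [(i <= m)%N]leqNgt lt_mi.
have := IHn m.+1 r; apply: sub_pairwise => s t /=.
by rewrite ltxi_cons lexx.
Qed.

Lemma incseqs_uniq m n r : uniq (incseqs m n r).
Proof. exact: sorted_uniq lt_trans lt_irreflexive _ (incseqs_sorted m n r). Qed.

(* The finite type of the indices 1 <= i_1 < ... < i_r <= n. *)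
Definition idx (n r : nat) : finType := seq_sub (incseqs 1 n r).

(* Tensor powers of a finite-dimensional space, with factors indexed by I: a  *)
(* tensor is given by its coordinates on the basis of pure tensors of vectors *)
(* of vbasis fullv.  The universal property is tlift_pure and tlift_unique.   *)
Section TensorPower.

Variables (k : fieldType) (V : vectType k) (I : finType).

Definition tpow : vectType k :=
  {ffun {ffun I -> 'I_(\dim {:V})} -> k^o}.

Definition tpure (v : {ffun I -> V}) : tpow :=
  [ffun f : {ffun I -> 'I_(\dim {:V})} =>
    \prod_i coord (vbasis {:V}) (f i) (v i)].

Definition upd (v : {ffun I -> V}) (i : I) (x : V) : {ffun I -> V} :=
  [ffun j => if j == i then x else v j].

Definition multilinear (W : lmodType k) (phi : {ffun I -> V} -> W) : Prop :=
  forall v i a x y,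
    phi (upd v i (a *: x + y)) = a *: phi (upd v i x) + phi (upd v i y).

Definition tlift (W : lmodType k) (phi : {ffun I -> V} -> W) (t : tpow) : W :=
  \sum_f t f *: phi [ffun i => (vbasis {:V})`_(f i)].

Fact tlift_linear (W : lmodType k) (phi : {ffun I -> V} -> W) :
  linear (tlift phi).
Proof.
move=> a t u; rewrite /tlift scaler_sumr -big_split /=.
by apply: eq_bigr => f _; rewrite !ffunE scalerDl scalerA.
Qed.

HB.instance Definition _ (W : lmodType k) (phi : {ffun I -> V} -> W) :=
  GRing.isLinear.Build k tpow W *:%R (tlift phi) (tlift_linear phi).

Lemma tpure_multilinear : multilinear tpure.
Proof.
move=> v i a x y; apply/ffunP => f; rewrite !ffunE.
have updE z : \prod_j coord (vbasis {:V}) (f j) (upd v i z j) =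
    coord (vbasis {:V}) (f i) z
      * \prod_(j | j != i) coord (vbasis {:V}) (f j) (v j).
  rewrite (bigD1 i) //= ffunE eqxx; congr (_ * _).
  by apply: eq_bigr => j /negbTE ji; rewrite ffunE ji.
by rewrite !updE linearP /= mulrDl -mulrA.
Qed.

Lemma multilinear_expand (W : lmodType k) (phi : {ffun I -> V} -> W) v i :
  multilinear phi ->
  phi v = \sum_j coord (vbasis {:V}) j (v i)
                   *: phi (upd v i (vbasis {:V})`_j).
Proof.
move=> phiL.
have phi0 : phi (upd v i 0) = 0.
  by have := phiL v i (-1) 0 0; rewrite scaler0 addr0 scaleN1r addNr.
have phi_sum (s : seq 'I_(\dim {:V})) c :
    phi (upd v i (\sum_(j <- s) c j *: (vbasis {:V})`_j)) =
    \sum_(j <- s) c j *: phi (upd v i (vbasis {:V})`_j).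
  by elim: s => [|j s IHs]; rewrite ?big_nil // !big_cons phiL IHs.
rewrite -phi_sum -coord_vbasis ?memvf //; congr phi.
by apply/ffunP => j; rewrite ffunE; case: eqP => // ->.
Qed.

Lemma multilinear_ext (W : lmodType k) (phi psi : {ffun I -> V} -> W) :
    multilinear phi -> multilinear psi ->
    (forall f : {ffun I -> 'I_(\dim {:V})},
       phi [ffun i => (vbasis {:V})`_(f i)]
       = psi [ffun i => (vbasis {:V})`_(f i)]) ->
  phi =1 psi.
Proof.
move=> phiL psiL eq_b v.
have [s] : exists s : seq I, forall i, i \notin s ->
    exists j : 'I_(\dim {:V}), v i = (vbasis {:V})`_j.
  by exists (enum I) => i; rewrite mem_enum.
elim: s v => [|i s IHs] v vP.
  have {}vP i := cid (vP i isT).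
  suff -> : v = [ffun i => (vbasis {:V})`_([ffun i => sval (vP i)] i)] by [].
  by apply/ffunP => i; rewrite !ffunE; case: (vP i).
rewrite (multilinear_expand v i phiL) (multilinear_expand v i psiL).
apply: eq_bigr => j _; rewrite (IHs (upd v i _)) // => i' i's.
rewrite ffunE; case: eqP => [_|/eqP ne]; first by exists j.
by apply: vP; rewrite inE negb_or ne.
Qed.

Lemma tpure_basis (f : {ffun I -> 'I_(\dim {:V})}) :
  tpure [ffun i => (vbasis {:V})`_(f i)] = [ffun g => (f == g)%:R].
Proof.
apply/ffunP => g; rewrite !ffunE.
have bfree : free (vbasis {:V}) := basis_free (vbasisP _).
case: eqP => [<-|/eqP fg].
  by rewrite big1 // => i _; rewrite ffunE coord_free // eqxx.
have [i fgi] : exists i, f i != g i.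
  apply/existsP; rewrite -negb_forall; apply: contra fg => /forallP fg.
  by apply/eqP/ffunP => i; apply/eqP.
rewrite (bigD1 i) //= ffunE coord_free //.
case: eqP => [fgE|_]; last by rewrite mul0r.
by rewrite -(inj_eq val_inj) fgE eqxx in fgi.
Qed.

Lemma tlift_pure (W : lmodType k) (phi : {ffun I -> V} -> W) v :
  multilinear phi -> tlift phi (tpure v) = phi v.
Proof.
move=> phiL; move: v; apply: multilinear_ext => //.
  by move=> v i a x y; rewrite tpure_multilinear linearP.
move=> f; rewrite tpure_basis /tlift (bigD1 f) //= ffunE eqxx scale1r.
rewrite big1 ?addr0 // => g gf.
by rewrite ffunE; case: eqP => [E|_]; [rewrite E eqxx in gf | exact: scale0r].
Qed.

Lemma tlift_unique (W : lmodType k) (phi : {ffun I -> V} -> W)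
    (g : {linear tpow -> W}) :
  (forall v, g (tpure v) = phi v) -> g =1 tlift phi.
Proof.
move=> g_phi t.
have -> : t = \sum_f t f *: tpure [ffun i => (vbasis {:V})`_(f i)].
  apply/ffunP => h; rewrite sum_ffunE (bigD1 h) //= ffunE tpure_basis ffunE.
  rewrite eqxx [_ *: _]mulr1 big1 ?addr0 // => f fh.
  rewrite ffunE tpure_basis ffunE; case: eqP => [E|_].
    by rewrite E eqxx in fh.
  exact: mulr0.
rewrite !linear_sum; apply: eq_bigr => f _; rewrite !linearZ /=; congr (_ *: _).
rewrite g_phi tpure_basis /tlift (bigD1 f) //= ffunE eqxx scale1r.
rewrite big1 ?addr0 // => h hf.
by rewrite ffunE; case: eqP => [E|_]; [rewrite E eqxx in hf | exact: scale0r].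
Qed.

End TensorPower.

(* The quotient of a finite-dimensional space by a subspace. *)
Section VectorQuotient.

Local Open Scope quotient_scope.

Variables (k : fieldType) (T : vectType k) (U : {vspace T}).

Definition vquot := Quotient.quot (U : zmodClosed T).

HB.instance Definition _ := GRing.Zmodule.on vquot.

Definition vproj (x : T) : vquot := \pi_vquot x.

Lemma vproj_eq x y : (vproj x == vproj y) = (x - y \in U).
Proof. by rewrite Quotient.idealrBE. Qed.

Lemma vproj_surj (q : vquot) : exists x, q = vproj x.
Proof. by exists (repr q); rewrite /vproj reprK. Qed.

Lemma vprojD x y : vproj (x + y) = vproj x + vproj y.
Proof. by rewrite /vproj !piE. Qed.

Definition vquot_scale (a : k) (q : vquot) : vquot := vproj (a *: repr q).

Lemma vprojZ a x : vproj (a *: x) = vquot_scale a (vproj x).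
Proof.
apply/eqP; rewrite /vquot_scale vproj_eq -scalerBr memvZ // -vproj_eq.
by rewrite /vproj reprK.
Qed.

Fact vquot_scalerA a b q :
  vquot_scale a (vquot_scale b q) = vquot_scale (a * b) q.
Proof. by have [x ->] := vproj_surj q; rewrite -!vprojZ scalerA. Qed.

Fact vquot_scale1r : left_id 1 vquot_scale.
Proof. by move=> q; have [x ->] := vproj_surj q; rewrite -vprojZ scale1r. Qed.

Fact vquot_scalerDr : right_distributive vquot_scale +%R.
Proof.
move=> a p q; have [x ->] := vproj_surj p; have [y ->] := vproj_surj q.
by rewrite -vprojD -!vprojZ -vprojD scalerDr.
Qed.

Fact vquot_scalerDl q : {morph vquot_scale^~ q : a b / a + b}.
Proof.
move=> a b; have [x ->] := vproj_surj q.
by rewrite -!vprojZ -vprojD scalerDl.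
Qed.

HB.instance Definition _ := GRing.Zmodule_isLmodule.Build k vquot
  vquot_scalerA vquot_scale1r vquot_scalerDr vquot_scalerDl.

Fact vproj_linear : linear vproj.
Proof. by move=> a x y; rewrite vprojD vprojZ. Qed.

HB.instance Definition _ :=
  GRing.isLinear.Build k T vquot *:%R vproj vproj_linear.

Fact vquot_vect_iso : Vector.axiom (\dim (U^C)) vquot.
Proof.
pose r (x : T) : T := x - projv U x.
have rL : linear r.
  move=> a x y; rewrite /r linearP scalerBr opprD !addrA.
  by congr (_ - _); rewrite addrAC.
have rC x : r x \in (U^C)%VS by exact: memv_projC.
have rK x : vproj (r x) = vproj x.
  by apply/eqP; rewrite vproj_eq addrAC subrr sub0r memvN memv_proj.
have r0 x : x \in U -> r x = 0 by move=> /projv_id xU; rewrite /r xU subrr.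
have r_id x : x \in (U^C)%VS -> r x = x.
  by rewrite -lker_proj memv_ker /r => /eqP ->; rewrite subr0.
pose c (q : vquot) : T := r (repr q).
have cE x : c (vproj x) = r x.
  apply/eqP; rewrite -subr_eq0 addrC -scaleN1r -rL scaleN1r addrC; apply/eqP.
  by apply: r0; rewrite -vproj_eq /vproj reprK.
exists (fun q => \row_i coord (vbasis U^C) i (c q)).
  move=> a p q; have [x ->] := vproj_surj p; have [y ->] := vproj_surj q.
  by apply/rowP => i; rewrite !mxE -vproj_linear !cE rL linearP.
exists (fun rw : 'rV_(\dim U^C) => vproj (\sum_i rw 0 i *: (vbasis U^C)`_i)).
  move=> q; have [x ->] := vproj_surj q; rewrite -[RHS]rK.
  rewrite [in RHS](coord_vbasis (rC x)); congr vproj.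
  by apply: eq_bigr => i _; rewrite mxE cE.
move=> rw; apply/rowP => i; rewrite mxE cE r_id.
  by rewrite coord_sum_free ?(basis_free (vbasisP _)).
by apply: rpred_sum => j _; rewrite rpredZ ?vbasis_mem ?memt_nth.
Qed.

HB.instance Definition _ := Lmodule_hasFinDim.Build k vquot vquot_vect_iso.

End VectorQuotient.

(* The subspace generated by an arbitrary, possibly infinite, set. *)
Section Span.

Variables (k : fieldType) (T : vectType k) (P : T -> Prop).

Lemma spanset_exists : exists U : {vspace T},
  forall W : {vspace T}, (U <= W)%VS <-> (forall x, P x -> x \in W).
Proof.
pose Q n := `[< exists2 s : seq T,
  forall x, x \in s -> P x & \dim <<s>>%VS = n >].
have Q0 : exists n, Q n.
  by exists (\dim (<<[::]>>%VS : {vspace T})); apply/asboolP; exists [::].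
have Qle n : Q n -> (n <= \dim {:T})%N.
  by move=> /asboolP[s _ <-]; rewrite dimvS ?subvf.
case: (ex_maxnP Q0 Qle) => n /asboolP[s sP <-] smax.
exists <<s>>%VS => W; split=> [/subvP sW x Px|PW]; last first.
  by apply/span_subvP => x /sP /PW.
apply: sW; have: (<<s>> <= <<x :: s>>)%VS.
  by apply/sub_span => y ys; rewrite inE ys orbT.
have xsP y : y \in x :: s -> P y by rewrite inE => /predU1P[->//|/sP].
have le_dim : (\dim <<x :: s>> <= \dim <<s>>)%N.
  by apply: smax; apply/asboolP; exists (x :: s).
move=> sxs; have /eqP -> : (<<s>> == <<x :: s>>)%VS by rewrite eqEdim sxs.
by rewrite memv_span ?mem_head.
Qed.

Definition spanset : {vspace T} := sval (cid spanset_exists).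

Lemma spansetP (W : {vspace T}) :
  (spanset <= W)%VS <-> (forall x, P x -> x \in W).
Proof. exact: (svalP (cid spanset_exists)). Qed.

End Span.

Lemma det_col_linear (k : fieldType) n (A B C : 'M[k]_n) q a :
    (forall p, A p q = a * B p q + C p q) ->
    (forall p q', q' != q -> A p q' = B p q') ->
    (forall p q', q' != q -> A p q' = C p q') ->
  \det A = a * \det B + \det C.
Proof.
move=> ABC AB AC; rewrite -(det_tr A) -(det_tr B) -(det_tr C).
rewrite (@determinant_multilinear _ _ A^T B^T C^T q a 1) ?mul1r //.
- by apply/rowP => p; rewrite !mxE ABC mul1r.
- by apply/matrixP => q' p; rewrite !mxE AB // eq_sym neq_lift.
- by apply/matrixP => q' p; rewrite !mxE AC // eq_sym neq_lift.
Qed.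

Section DetS.

Variables (k : fieldType) (V : vectType k).

(* v_{i_1,...,i_r} for s = [:: i_1; ...; i_r]; it is 0 if s is not an index. *)
Definition at_idx n r (v : {ffun idx n r -> V}) (s : seq nat) : V :=
  if insub s is Some i then v i else 0.

(* The left-hand side of the equation indexed by m = [:: m_1; ...; m_(r-1)];  *)
(* nth 0 (0 :: m) j is m_j, with m_0 = 0, and nth n.+1 m j is m_(j+1), with   *)
(* m_r = n + 1.                                                               *)
Definition equation n r (v : {ffun idx n r -> V}) (lambda : seq nat -> k)
    (m : seq nat) : V :=
  \sum_(0 <= j < r) \sum_((nth 0%N (0%N :: m) j).+1 <= s < nth n.+1 m j)
    ((-1) ^+ (s.-1 + j) * lambda (take j m ++ s :: drop j m))
      *: at_idx v (take j m ++ s :: drop j m).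

Variables (d : nat) (e : d.-tuple V) (r : nat).

Fact ltn_mod_ord N (p : 'I_(d * N)) : (p %% d < d)%N.
Proof. by rewrite ltn_pmod //; case: (d) p => // -[]; rewrite mul0n. Qed.

(* Row p is the coordinate p %% d (counted from 0) of the equation of the     *)
(* block p %/ d; column q is read off by setting lambda to 1 at the q-th      *)
(* index and 0 elsewhere.  For r > 0 there are d * 'C((r * d).-1, r.-1)       *)
(* columns: see size_cols.                                                    *)
Definition matA (v : {ffun idx (r * d) r -> V}) :
    'M[k]_(d * 'C((r * d).-1, r.-1)) :=
  \matrix_(p, q)
    let m := nth [::] (incseqs 1 (r * d).-1 r.-1) (p %/ d) in
    let t := nth [::] (incseqs 1 (r * d) r) q in
    coord e (Ordinal (ltn_mod_ord p)) (equation v (fun s => (s == t)%:R) m).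

(* The linear map whose value at a pure tensor is det (matA v): see           *)
(* detS_pure, which holds for r > 0.                                          *)
Definition detS : tpow V (idx (r * d) r) -> k^o :=
  tlift (fun v => \det (matA v) : k^o).

HB.instance Definition _ := GRing.Linear.on detS.

(* The index t of the definition of e_{i_1,...,i_r} satisfies                 *)
(* t - 1 = (i_1 + ... + i_r) mod r, so i_t is the entry of s at this position *)
(* counted from 0; and a number i > 0 lies in S_a for a = (i - 1) / r + 1,    *)
(* so that e_a is the entry of e at position (i - 1) / r.                     *)
Definition tensorE : tpow V (idx (r * d) r) :=
  tpure [ffun i : idx (r * d) r =>
    let s := val i in let i_t := nth 0%N s (sumn s %% r) in
    e`_(i_t.-1 %/ r)].

Lemma size_cols : (0 < r)%N ->
  size (incseqs 1 (r * d) r) = (d * 'C((r * d).-1, r.-1))%N.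
Proof.
rewrite size_incseqs; case: r => // r' _.
apply/eqP; rewrite -(eqn_pmul2l (ltn0Sn r')) mulnA; apply/eqP.
by rewrite -mul_bin_diag.
Qed.

Lemma equation_delta n (v : {ffun idx n r -> V}) t m :
  equation v (fun s => (s == t)%:R) m =
  (\sum_(0 <= j < r) \sum_((nth 0%N (0%N :: m) j).+1 <= s < nth n.+1 m j)
    (if take j m ++ s :: drop j m == t then (-1) ^+ (s.-1 + j) else 0))
      *: at_idx v t.
Proof.
rewrite /equation scaler_suml; apply: eq_bigr => j _.
rewrite scaler_suml; apply: eq_bigr => s _.
by case: eqP => [->|_]; rewrite ?mulr1 // mulr0 !scale0r.
Qed.

Lemma at_idx_upd n (v : {ffun idx n r -> V}) i x s :
  at_idx (upd v i x) s = if s == val i then x else at_idx v s.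
Proof.
rewrite /at_idx; case: insubP => [j sP <-|sN].
  by rewrite ffunE -val_eqE.
by case: eqP => // si; rewrite si (valP i) in sN.
Qed.

Lemma matAE v (p q : 'I_(d * 'C((r * d).-1, r.-1))) :
  let m := nth [::] (incseqs 1 (r * d).-1 r.-1) (p %/ d) in
  let t := nth [::] (incseqs 1 (r * d) r) q in
  matA v p q =
  (\sum_(0 <= j < r) \sum_((nth 0%N (0%N :: m) j).+1 <= s < nth (r * d).+1 m j)
    (if take j m ++ s :: drop j m == t then (-1) ^+ (s.-1 + j) else 0))
      * coord e (Ordinal (ltn_mod_ord p)) (at_idx v t).
Proof.
by move=> m t; rewrite mxE; cbv zeta; rewrite equation_delta linearZ.
Qed.

Lemma det_matA_multilinear : (0 < r)%N ->
  multilinear (fun v => \det (matA v) : k^o).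
Proof.
move=> r_gt0 v i a x y.
have lt_q : (index (val i) (incseqs 1 (r * d) r)
              < d * 'C((r * d).-1, r.-1))%N.
  by rewrite -size_cols // index_mem (valP i).
pose q := Ordinal lt_q.
have nth_q : nth [::] (incseqs 1 (r * d) r) q = val i.
  by rewrite nth_index ?(valP i).
have nth_neq (q' : 'I_(d * 'C((r * d).-1, r.-1))) :
    q' != q -> (nth [::] (incseqs 1 (r * d) r) q' == val i) = false.
  move=> ne; rewrite -nth_q nth_uniq ?incseqs_uniq ?size_cols //.
  exact: negbTE.
apply: (det_col_linear (q := q)) => [p|p q' /nth_neq neq|p q' /nth_neq neq].
- rewrite 3!matAE 3!at_idx_upd nth_q eqxx linearP /=.
  by rewrite mulrDr mulrCA.
- by rewrite 2!matAE 2!at_idx_upd neq.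
- by rewrite 2!matAE 2!at_idx_upd neq.
Qed.

Lemma detS_pure v : (0 < r)%N -> detS (tpure v) = \det (matA v).
Proof.
by move=> r_gt0; rewrite /detS tlift_pure //; apply: det_matA_multilinear.
Qed.

End DetS.

Section LambdaS.

Variables (k : fieldType) (V : vectType k).

Definition lambda_relation (r n : nat) (t : tpow V (idx n r)) : Prop :=
  exists2 v : {ffun idx n r -> V}, t = tpure v &
  exists2 x, x \in incseqs 1 n r.+1 &
    forall i j : idx n r,
      {subset val i <= x} -> {subset val j <= x} -> v i = v j.

Definition LambdaS (r n : nat) : vectType k :=
  vquot (spanset (@lambda_relation r n)).

End LambdaS.

Arguments LambdaS {k} V r n.

(* Main.v *)
Require Import Defs.
From mathcomp Require Import all_boot all_order all_algebra.
From mathcomp Require Import all_fingroup all_field boolp zify ring.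

Set Implicit Arguments.
Unset Strict Implicit.

Import GRing.Theory.
Local Open Scope ring_scope.

(* Up to signs and up to the order of rows and columns, A is block diagonal   *)
(* with a block for each basis vector e_c, and each block is a submatrix of   *)
(* the boundary matrix of a simplex.  So a kernel vector gives, for each c, a *)
(* cycle x supported on the r-subsets t whose selected element lies in S_c.   *)
(* Pair x with functions psi_1, ..., psi_r on {1, ..., rd} by                 *)
(*   sum_t x_t det(psi_i(t_l)).                                               *)
(* This is alternating, and it vanishes if some psi_i is constant.  If b of   *)
(* the functions are supported on S_c and the others vanish on S_c, it is     *)
(* zero, by induction on b.  Indeed, S_c is a complete residue system mod r,  *)
(* so these b functions may be taken to be characters u |-> alpha_i^u of S_c  *)
(* with alpha_i^r = 1, and the alpha_i may be taken to be distinct.  Only the *)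
(* t with |t :&: S_c| = b contribute, and with weights w(u) = u - 1 below S_c *)
(* and w(u) = u elsewhere, their selected element is in S_c only if           *)
(* w(t) mod r < b.  Hence the pairing of x with the functions                 *)
(* u |-> zeta^w(u) psi_i(u), for zeta^r = 1, is a polynomial in zeta of size  *)
(* at most b.  It vanishes at the b points zeta = alpha_i^-1, because there   *)
(* the i-th function is the indicator of S_c, that is, the constant 1 minus   *)
(* the indicator of the complement; so it also vanishes at zeta = 1.          *)
(* The roots of unity are those of algC: det(A) comes from an integer.        *)
(* Finally det^{S^r} factors through Lambda, since the relation of the        *)
(* columns indexed by the facets of an r-simplex is again that the boundary   *)
(* of a boundary is zero.                                                     *)

(** A zero determinant yields a nonzero kernel vector ([det_matA_eq0]), whose c-th coordinate is, up
    to signs, a cycle x on the r-subsets that select S_c ([coord_equation]); [block_acyclic] says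
    that x is zero. Indeed x is recovered from pairings with point masses ([pairing_delta]), and
    each point mass lies inside S_c or outside it, so [pairing_adapted] suffices. Its induction on
    the number b of functions supported on S_c plays two counts against each other: the selection
    rule leaves only b exponents of zeta ([selected_excess], [adapted_card]), while the cycle
    condition ([pairing_cycle]) and the induction hypothesis give b distinct roots.

    This uses primitive roots of unity; [det_int_matA_neq0] transfers the result from [algC] to the
    integers, hence to characteristic zero. For the dimension, [det_matA_relation] finds the
    boundary of a simplex in the kernel, so [detS] kills the relations. *)

Definition face (j : nat) (t : seq nat) : seq nat := take j t ++ drop j.+1 t.

Definition insert (j s : nat) (m : seq nat) : seq nat :=
  take j m ++ s :: drop j m.

Definition gap (n : nat) (m : seq nat) (j : nat) : seq nat :=
  index_iota (nth 0%N (0%N :: m) j).+1 (nth n.+1 m j).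

Lemma face_insert j s m : (j <= size m)%N -> face j (insert j s m) = m.
Proof.
move=> le_jm; have st : size (take j m) = j by rewrite size_takel.
rewrite /face /insert take_size_cat // drop_cat st ltnNge leqnSn /=.
by rewrite subSnn drop1 /= cat_take_drop.
Qed.

Lemma insert_face j t : (j < size t)%N -> insert j (nth 0%N t j) (face j t) = t.
Proof.
move=> lt_jt; have st : size (take j t) = j by rewrite size_takel // ltnW.
rewrite /face /insert take_size_cat // drop_size_cat //.
by rewrite -drop_nth // cat_take_drop.
Qed.

Lemma size_insert j s m : size (insert j s m) = (size m).+1.
Proof. by rewrite size_cat /= addnS -size_cat cat_take_drop. Qed.

Lemma size_face j t : (j < size t)%N -> size (face j t) = (size t).-1.
Proof. by move=> lt_jt; rewrite -[in RHS](insert_face lt_jt) size_insert. Qed.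

Lemma sumn_insert j s m : sumn (insert j s m) = (s + sumn m)%N.
Proof. by rewrite sumn_cat /= addnCA -sumn_cat cat_take_drop. Qed.

Lemma nth_face j t l : (j <= size t)%N ->
  nth 0%N (face j t) l = nth 0%N t (bump j l).
Proof.
move=> le_jt; rewrite nth_cat size_takel // /bump ltnNge.
case: leqP => le_jl /=; last by rewrite nth_take.
by rewrite nth_drop addSn subnKC.
Qed.

Lemma path_insert n lo j s m : (j <= size m)%N ->
  path ltn lo (insert j s m) && all (fun i => i <= n)%N (insert j s m) =
  [&& path ltn lo m, all (fun i => i <= n)%N m
    & nth 0%N (lo :: m) j < s < nth n.+1 m j]%N.
Proof.
elim: m j lo => [|a m IHm] [|j] lo // le_jm.
- by rewrite /insert /= !andbT ltnS.
- by rewrite /insert /=; move: (path _ _ _) (all _ _) => b1 b2; lia.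
move: (IHm j a le_jm); rewrite /insert /=.
move: (path _ _ _) (all _ _) (path _ _ _) (all _ _) => b1 b2 b3 b4.
by case: (lo < a)%N => //=; case: (a <= n)%N => /=; lia.
Qed.

Lemma mem_incseqs1 n r t : (t \in incseqs 1 n r) =
  [&& size t == r, path ltn 0%N t & all (fun i => i <= n)%N t].
Proof.
rewrite mem_incseqs; congr (_ && _).
by rewrite (path_sortedE ltn_trans) -andbA andbCA -all_predI.
Qed.

Lemma insert_incseqs n r j s m : (j <= r)%N -> size m = r ->
  (insert j s m \in incseqs 1 n r.+1) =
  (m \in incseqs 1 n r) && (s \in gap n m j).
Proof.
move=> le_jr sm; rewrite !mem_incseqs1 size_insert sm !eqxx /=.
by rewrite path_insert ?sm // mem_index_iota -andbA.
Qed.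

Lemma face_incseqs n r X j : X \in incseqs 1 n r.+1 -> (j <= r)%N ->
  face j X \in incseqs 1 n r.
Proof.
move=> X_n le_jr; have := X_n; rewrite mem_incseqs => /and3P[/eqP sX _ _].
have lt_j : (j < size X)%N by rewrite sX.
have := X_n; rewrite -{1}(insert_face lt_j) insert_incseqs //.
  by case/andP.
by rewrite size_face // sX.
Qed.

Lemma incseqs_nth n r t l : t \in incseqs 1 n r -> (l < r)%N ->
  (1 <= nth 0%N t l <= n)%N.
Proof.
rewrite mem_incseqs => /and3P[/eqP <- _ /all_nthP t_n] lt_l.
by have := t_n 0%N l lt_l; rewrite add1n ltnS.
Qed.

(** Deleting the j-th entry and inserting into the j-th gap are inverse bijections; this turns
    Laplace expansions over t into boundary sums over m. *)
Lemma big_incseqs_face (R : nmodType) n r j (G : seq nat -> seq nat -> R) :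
  (j <= r)%N ->
  \sum_(t <- incseqs 1 n r.+1) G (face j t) t =
  \sum_(m <- incseqs 1 n r) \sum_(s <- gap n m j) G m (insert j s m).
Proof.
move=> le_jr.
have size_r r0 m : m \in incseqs 1 n r0 -> size m = r0.
  by rewrite mem_incseqs => /and3P[/eqP].
rewrite (@perm_big _ _ _ _ _
  [seq insert j s m | m <- incseqs 1 n r, s <- gap n m j]); last first.
  apply: uniq_perm; first exact: incseqs_uniq.
    apply: allpairs_uniq_dep => [|m _|]; first exact: incseqs_uniq.
      exact: iota_uniq.
    move=> u u' /allpairsPdep[m [s [/size_r sm _ ->{u}]]].
    move=> /allpairsPdep[m' [s' [/size_r sm' _ ->{u'}]]] /= eq_ins.
    have em : m = m'.
      by rewrite -(@face_insert j s m) ?sm // eq_ins face_insert ?sm'.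
    (* Once m is known, s is read off from the sum of the entries. *)
    rewrite em; move/(congr1 sumn): eq_ins.
    by rewrite !sumn_insert em => /addIn ->.
  move=> t; apply/idP/allpairsPdep => [t_r|[m [s [m_r s_m ->]]]].
    have st := size_r _ _ t_r; have lt_jt : (j < size t)%N by rewrite st ltnS.
    have sf : size (face j t) = r by rewrite size_face // st.
    exists (face j t), (nth 0%N t j); rewrite insert_face //.
    move: t_r; rewrite -{1}(insert_face lt_jt) insert_incseqs //.
    by case/andP.
  by rewrite insert_incseqs ?(size_r _ _ m_r) // m_r.
rewrite big_allpairs_dep big_seq [RHS]big_seq; apply: eq_bigr => m /size_r sm.
by apply: eq_bigr => s _; rewrite face_insert ?sm.
Qed.

(** * Alternating pairing of chains with families of functions *)

Section Pairing.

Variables (F : fieldType) (n : nat).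

Definition minor_mx r (psi : 'I_r -> nat -> F) (t : seq nat) : 'M[F]_r :=
  \matrix_(i, l) psi i (nth 0%N t l).

Definition pairing r (x : seq nat -> F) (psi : 'I_r -> nat -> F) : F :=
  \sum_(t <- incseqs 1 n r) x t * \det (minor_mx psi t).

Definition slot r (psi : 'I_r -> nat -> F) (i : 'I_r) (f : nat -> F) :=
  fun i' : 'I_r => if i' == i then f else psi i'.

Definition boundary r (x : seq nat -> F) (m : seq nat) : F :=
  \sum_(0 <= j < r) \sum_(s <- gap n m j) (-1) ^+ j * x (insert j s m).

Lemma slot_id r (psi : 'I_r -> nat -> F) i : slot psi i (psi i) = psi.
Proof. by apply: funext => i'; rewrite /slot; case: eqP => [->|]. Qed.

Lemma pairing_alternate r x (psi : 'I_r -> nat -> F) i j :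
  i != j -> psi i =1 psi j -> pairing x psi = 0.
Proof.
move=> neq_ij eq_ij; apply: big1 => t _.
by rewrite (determinant_alternate neq_ij) ?mulr0 // => l; rewrite !mxE.
Qed.

(** Multilinearity, stated through a density [kappa] independent of f, so that linear identities
    between slot functions become identities between sums. *)
Lemma pairing_slot r x (psi : 'I_r -> nat -> F) i : exists kappa : nat -> F,
  forall f, pairing x (slot psi i f) = \sum_(1 <= u < n.+1) f u * kappa u.
Proof.
pose C t l := cofactor (minor_mx psi t) i l.
exists (fun u => \sum_(t <- incseqs 1 n r) x t *
                   \sum_(l < r) (nth 0%N t l == u)%:R * C t l) => f.
under eq_bigr do rewrite mulr_sumr.
rewrite exchange_big /pairing big_seq [RHS]big_seq; apply: eq_bigr => t t_n.
under eq_bigr do rewrite mulrCA mulr_sumr.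
rewrite -mulr_sumr exchange_big (expand_det_row _ i); congr (_ * _).
apply: eq_bigr => l _; rewrite mxE /slot eqxx.
have -> : cofactor (minor_mx (slot psi i f) t) i l = C t l.
  congr (_ * \det _); apply/matrixP => i' l'.
  by rewrite !mxE /slot eq_sym (negbTE (neq_lift _ _)).
under eq_bigr do rewrite mulrA.
rewrite -mulr_suml; congr (_ * _).
have := incseqs_nth t_n (ltn_ord l); move: (nth _ _ _) => v v_n.
rewrite (bigD1_seq v) ?iota_uniq ?mem_index_iota //= eqxx mulr1.
by rewrite big1 ?addr0 // => u /negbTE uv; rewrite eq_sym uv mulr0.
Qed.

(** Multilinear reduction: the slots are replaced one at a time by functions of the smaller class
    Q. *)
Lemma slotwise r (Z : ('I_r -> nat -> F) -> Prop)
    (P Q : 'I_r -> (nat -> F) -> Prop) :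
    (forall i f, Q i f -> P i f) ->
    (forall psi i, (forall j, P j (psi j)) ->
       (forall f, Q i f -> Z (slot psi i f)) -> Z psi) ->
    (forall psi, (forall i, Q i (psi i)) -> Z psi) ->
  forall psi, (forall i, P i (psi i)) -> Z psi.
Proof.
move=> QP step ZQ psi psiP.
have [s] : exists s : seq 'I_r, forall i, i \notin s -> Q i (psi i).
  by exists (enum 'I_r) => i; rewrite mem_enum.
elim: s psi psiP => [|i s IHs] psi psiP psiQ; first by apply: ZQ => i;
  apply: psiQ.
apply: (step psi i psiP) => f fQ; apply: IHs => j; rewrite /slot.
  by case: eqP => [->|_]; [apply: QP | apply: psiP].
case: eqP => [->//|/eqP ji] js; apply: psiQ.
by rewrite inE negb_or ji.
Qed.

(** Laplace expansion along the row of ones produces the alternating sum over the faces of t. *)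
Lemma pairing_const_slot r x (psi : 'I_r.+1 -> nat -> F) i :
  psi i = (fun=> 1) ->
  pairing x psi = (-1) ^+ i *
    \sum_(m <- incseqs 1 n r) boundary r.+1 x m
       * \det (minor_mx (fun j => psi (lift i j)) m).
Proof.
move=> psi_i; pose D m := \det (minor_mx (fun j => psi (lift i j)) m).
have expand t : t \in incseqs 1 n r.+1 ->
    x t * \det (minor_mx psi t) =
    (-1) ^+ i * \sum_(0 <= j < r.+1) (-1) ^+ j * x t * D (face j t).
  rewrite mem_incseqs => /and3P[/eqP st _ _].
  rewrite (expand_det_row _ i) mulr_sumr big_mkord mulr_sumr.
  apply: eq_bigr => l _; rewrite mxE psi_i mul1r /cofactor exprD.
  have -> : \det (row' i (col' l (minor_mx psi t))) = D (face l t).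
    by congr (\det _); apply/matrixP => i' l'; rewrite !mxE nth_face // st ltnW.
  by rewrite !mulrA [x t * _]mulrC; congr (_ * _);
    rewrite -!mulrA [x t * _]mulrC.
rewrite /pairing big_seq (eq_bigr _ expand) -big_seq -mulr_sumr exchange_big.
congr (_ * _) => /=.
under [RHS]eq_bigr do rewrite /boundary mulr_suml.
rewrite [RHS]exchange_big big_nat [RHS]big_nat;
  apply: eq_bigr => j /andP[_ lt_jr].
rewrite (big_incseqs_face n (fun m t => (-1) ^+ j * x t * D m)) //.
by apply: eq_bigr => m _; rewrite mulr_suml.
Qed.

(** The minor at t is the identity; any other t' misses an entry of t, so its minor has a zero
    row. *)
Lemma pairing_delta r x t : t \in incseqs 1 n r ->
  pairing x (fun (i : 'I_r) u => (u == nth 0%N t i)%:R) = x t.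
Proof.
move=> t_n; have := t_n; rewrite mem_incseqs => /and3P[/eqP st st_lt _].
have uniq_t : uniq t := sorted_uniq ltn_trans ltnn st_lt.
rewrite /pairing (bigD1_seq t) ?incseqs_uniq //= big_seq_cond big1 ?addr0.
  rewrite [X in \det X](_ : _ = 1%:M) ?det1 ?mulr1 //.
  by apply/matrixP => i l; rewrite !mxE nth_uniq ?st // eq_sym.
move=> t' /andP[]; rewrite mem_incseqs => /and3P[/eqP st' st'_lt _] neq_t.
have [i ti] : exists i : 'I_r, nth 0%N t i \notin t'.
  apply/existsP; rewrite -negb_forall; apply: contra neq_t => /forallP tt'.
  have sub_t : {subset t <= t'}.
    move=> u /(nthP 0%N)[i]; rewrite st => lt_i <-; exact: (tt' (Ordinal lt_i)).
  have [_ eq_t] := uniq_min_size uniq_t sub_t (eq_leq (etrans st' (esym st))).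
  by apply/eqP; symmetry; apply: (irr_sorted_eq ltn_trans ltnn).
rewrite (expand_det_row _ i) big1 ?mulr0 // => l _; rewrite mxE.
case: eqP => [E|_]; last by rewrite mul0r.
by rewrite -E mem_nth ?st' in ti.
Qed.

End Pairing.

(** * Arithmetic of the selection rule *)

Definition selected (r : nat) (t : seq nat) : nat :=
  ((nth 0%N t (sumn t %% r)).-1 %/ r)%N.

(** This is S_a for a = c + 1. *)
Definition block (r c : nat) : pred nat := fun u => (r * c < u <= r * c + r)%N.

Definition weight (r c u : nat) : nat := (u - (u <= r * c))%N.

(* If [selected r t = c] then there is no truncation, and the total weight of *)
(* [t] is congruent to this number mod [r].                                   *)
Definition excess (r c : nat) (t : seq nat) : nat :=
  (sumn t %% r - count (fun u => u <= r * c)%N t)%N.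

Lemma nth_le_count M p t : sorted ltn t -> (p < size t)%N ->
  (nth 0%N t p <= M)%N = (p < count (fun u => u <= M)%N t)%N.
Proof.
elim: t p => [|a t IHt] // p; rewrite /= (path_sortedE ltn_trans).
case/andP=> /allP lt_at t_lt; rewrite ltnS => lt_pt.
case: (leqP a M) => [le_aM|lt_Ma] /=.
  by case: p lt_pt => [|p] lt_pt //=; rewrite IHt // ltnS.
rewrite (@eq_in_count _ _ pred0) ?count_pred0 => [|u /lt_at lt_au]; last first.
  by apply/negbTE; rewrite -ltnNge (ltn_trans lt_Ma lt_au).
apply/negbTE; rewrite -ltnNge; case: p lt_pt => [|p] lt_pt //=.
exact: ltn_trans lt_Ma (lt_at _ (mem_nth _ _)).
Qed.

(** Since t is sorted, its entries in S_a occupy consecutive positions, right after the entries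
    below S_a. The selected position must be one of them. *)
Lemma selected_excess n r c t : (0 < r)%N -> t \in incseqs 1 n r ->
    selected r t = c ->
  (count (fun u => u <= r * c)%N t <= sumn t %% r)%N /\
  (excess r c t < count (block r c) t)%N.
Proof.
move=> r_gt0 t_n; have := t_n; rewrite mem_incseqs => /and3P[/eqP st t_lt _].
have lt_p : (sumn t %% r < size t)%N by rewrite st ltn_pmod.
have t_gt0 : (0 < nth 0%N t (sumn t %% r))%N.
  by case/andP: (incseqs_nth t_n (ltn_pmod (sumn t) r_gt0)).
rewrite /selected => sel_t.
have := nth_le_count (r * c) t_lt lt_p.
have := nth_le_count (r * c + r) t_lt lt_p.
have -> : (nth 0 t (sumn t %% r) <= r * c + r)%N.
  rewrite -sel_t -mulnSr mulnC -(prednK t_gt0).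
  by rewrite ltn_ceil.
have -> : (nth 0 t (sumn t %% r) <= r * c)%N = false.
  apply/negbTE; rewrite -ltnNge -sel_t mulnC -[X in (_ < X)%N](prednK t_gt0).
  by rewrite ltnS leq_trunc_div.
have -> : count (fun u => u <= r * c + r)%N t =
    (count (fun u => u <= r * c)%N t + count (block r c) t)%N.
  elim: {t_n st t_lt lt_p t_gt0 sel_t} t => //= u t ->.
  by rewrite addnACA; congr (_ + _)%N; rewrite /block; lia.
by rewrite /excess; lia.
Qed.

Lemma sumn_weight n r c t : t \in incseqs 1 n r ->
  (sumn (map (weight r c) t) + count (fun u => u <= r * c)%N t = sumn t)%N.
Proof.
rewrite mem_incseqs1 => /and3P[_ t_gt0 _].
have {t_gt0} : all (fun u => 0 < u)%N t.
  by move: t_gt0; rewrite (path_sortedE ltn_trans) => /andP[].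
elim: t => //= u t IHt /andP[u_gt0 /IHt <-]; rewrite /weight.
by case: leqP => _ /=; lia.
Qed.

(** * Roots of unity and functions adapted to a block *)

Section BlockKernel.

Variables (F : fieldType) (r c : nat).

Lemma unity_neq0 (zeta : F) : (0 < r)%N -> zeta ^+ r = 1 -> zeta != 0.
Proof.
by move=> r_gt0; apply: contra_eq_neq => ->;
  rewrite expr0n gtn_eqF // eq_sym oner_neq0.
Qed.

Lemma expr_weight n (zeta : F) t : (0 < r)%N -> zeta ^+ r = 1 ->
    t \in incseqs 1 n r -> selected r t = c ->
  zeta ^+ sumn (map (weight r c) t) = zeta ^+ excess r c t.
Proof.
move=> r_gt0 zeta_r t_n sel_t; have [le_a _] := selected_excess r_gt0 t_n sel_t.
have zeta_neq0 := unity_neq0 r_gt0 zeta_r.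
apply: (mulIf (expf_neq0 (count (fun u => u <= r * c)%N t) zeta_neq0)).
by rewrite -!exprD (sumn_weight c t_n) subnK // expr_mod.
Qed.

Lemma det_minor_scale (psi : 'I_r -> nat -> F) (f : nat -> F) t :
  \det (minor_mx (fun i u => f u * psi i u) t) =
  (\prod_(l < r) f (nth 0%N t l)) * \det (minor_mx psi t).
Proof.
rewrite mulrC; transitivity (\det (minor_mx psi t *m
    diag_mx (\row_(l < r) f (nth 0%N t l)))).
  by congr (\det _); apply/matrixP => i l; rewrite mul_mx_diag !mxE mulrC.
by rewrite det_mulmx det_diag; congr (_ * _); apply: eq_bigr => l _;
  rewrite mxE.
Qed.

Lemma prod_expr_weight (zeta : F) t : size t = r ->
  \prod_(l < r) zeta ^+ weight r c (nth 0%N t l) =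
  zeta ^+ sumn (map (weight r c) t).
Proof.
by move=> st; rewrite prodrXr sumnE big_map (big_nth 0%N) st big_mkord.
Qed.

Definition adapted (B : {set 'I_r}) (psi : 'I_r -> nat -> F) : Prop :=
  forall i u, block r c u != (i \in B) -> psi i u = 0.

(** A nonzero Leibniz term matches the rows in B with the entries of t in the block. *)
Lemma adapted_card B psi t : adapted B psi -> size t = r ->
  \det (minor_mx psi t) != 0 -> count (block r c) t = #|B|.
Proof.
move=> psiB st; apply: contraNeq => neq_B; apply/eqP; apply: big1 => s _.
have [i neq_i] : exists i, block r c (nth 0%N t (s i)) != (i \in B).
  apply/existsP; rewrite -negb_forall; apply: contra neq_B => /forallP eq_B.
  rewrite -sum1_card big_mkcond -sumn_count sumnE big_map (big_nth 0%N) st.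
  rewrite big_mkord (reindex_inj (@perm_inj _ s)); apply/eqP/eq_bigr => i _.
  by rewrite (eqP (eq_B i)); case: (i \in B).
by rewrite (bigD1 i) //= mxE psiB // mul0r mulr0.
Qed.

Definition character (alpha : F) (u : nat) : F :=
  if block r c u then alpha ^+ u else 0.

(** A Vandermonde argument: the values of [kappa] on the block are the coefficients of a polynomial
    of size at most r that vanishes at all r powers of z. *)
Lemma characters_span (z : F) (kappa : nat -> F) (f : nat -> F) d :
    r.-primitive_root z -> (c < d)%N ->
    (forall k, \sum_(1 <= u < (r * d).+1) character (z ^+ k) u * kappa u = 0) ->
    (forall u, ~~ block r c u -> f u = 0) ->
  \sum_(1 <= u < (r * d).+1) f u * kappa u = 0.
Proof.
move=> z_prim lt_cd char0 f0; have r_gt0 := prim_order_gt0 z_prim.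
have z_neq0 := unity_neq0 r_gt0 (prim_expr_order z_prim).
have block_sum (g : nat -> F) : (forall u, ~~ block r c u -> g u = 0) ->
    \sum_(1 <= u < (r * d).+1) g u * kappa u =
    \sum_(j < r) g (r * c + j.+1)%N * kappa (r * c + j.+1)%N.
  move=> g0; have le_n : (r * c + r <= r * d)%N by rewrite -mulnSr leq_mul2l
    lt_cd orbT.
  rewrite (@big_cat_nat _ _ _ (r * c).+1) /=; [|lia|lia].
  rewrite [X in _ + X](@big_cat_nat _ _ _ (r * c + r).+1) /=; [|lia|lia].
  rewrite big_nat big1 ?add0r => [|u u_low];
    last by rewrite g0 ?mul0r // /block; lia.
  rewrite [X in _ + X]big_nat [X in _ + X]big1 ?addr0 => [|u u_high];
    last first.
    by rewrite g0 ?mul0r // /block; lia.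
  have -> : (r * c + r).+1 = (r + (r * c).+1)%N by lia.
  rewrite -{1}[(r * c).+1]add0n big_addn addnK big_mkord; apply: eq_bigr => j _.
  by rewrite !addnS [(j + _)%N]addnC.
pose q := \poly_(j < r) kappa (r * c + j.+1)%N.
have q_root k : q.[z ^+ k] = 0.
  (* The first element of the block is r * c + 1, so the character carries this extra nonzero
     factor. *)
  apply: (mulfI (expf_neq0 (r * c).+1 (expf_neq0 k z_neq0))).
  rewrite mulr0 -[RHS](char0 k) block_sum => [|u /negbTE]; last first.
    by rewrite /character => ->.
  rewrite horner_poly mulr_sumr; apply: eq_bigr => j _.
  rewrite /character /block ifT; last by have := ltn_ord j; lia.
  by rewrite mulrCA mulrC -exprD addSnnS.
have q0 : q = 0.
  apply: (@roots_geq_poly_eq0 _ _ [seq z ^+ k | k <- iota 0 r]).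
  - by apply/allP => _ /mapP[k _ ->]; apply/rootP.
  - rewrite map_inj_in_uniq ?iota_uniq // => k k';
    rewrite !mem_iota /= => lt_k lt_k'.
    by move/eqP; rewrite (eq_prim_root_expr z_prim) !modn_small // => /eqP.
  - by rewrite size_map size_iota size_poly.
rewrite block_sum //; apply: big1 => j _.
have := coef_poly r (fun j => kappa (r * c + j.+1)%N) j.
by rewrite -/q q0 coef0 ltn_ord => <-; rewrite mulr0.
Qed.

End BlockKernel.

(** The boundary is only known to vanish at faces avoiding n. Subtracting multiples of the constant
    slot makes all other slots vanish at n, which kills the minors at faces containing n. *)
Lemma pairing_cycle (F : fieldType) n r (x : seq nat -> F) psi (i : 'I_r) :
    (forall m, m \in incseqs 1 n.-1 r.-1 -> boundary n r x m = 0) ->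
    psi i = (fun=> 1) ->
  pairing n x psi = 0.
Proof.
case: r psi i => [|r] psi i; first by case: i.
move=> cycle_x psi_i.
apply: (@slotwise _ _ (fun phi => pairing n x phi = 0)
  (fun j f => j = i -> f = fun=> 1)
  (fun j f => if j == i then f = fun=> 1 else f n = 0)) => [j f|{psi_i}{}psi j
    psiP|{psi_i}{}psi psiQ|j ->//].
- by case: eqP.
- case: (eqVneq j i) => [ji|neq_ji] Z.
    by rewrite -(slot_id psi j); apply: Z; apply: psiP.
  have [kappa kappaE] := pairing_slot n x psi j.
  have diff0 := Z (fun u => psi j u - psi j n) (subrr _).
  have const0 : pairing n x (slot psi j (fun=> 1)) = 0.
    apply: (@pairing_alternate _ _ _ _ _ j i) => //.
    by move=> u; rewrite /slot eqxx eq_sym (negbTE neq_ji) psiP.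
  transitivity (pairing n x (slot psi j (fun u => psi j u - psi j n)) +
      psi j n * pairing n x (slot psi j (fun=> 1))).
    rewrite -{1}(slot_id psi j) !kappaE mulr_sumr -big_split.
    by apply: eq_bigr => u _; rewrite /= mulrBl mul1r subrK.
  by rewrite const0 diff0 mulr0 addr0.
rewrite (pairing_const_slot _ _ (i := i)); last by have := psiQ i; rewrite eqxx.
rewrite big_seq big1 ?mulr0 // => m m_n.
have [/cycle_x ->|] := boolP (m \in incseqs 1 n.-1 r); first by rewrite mul0r.
have := m_n; rewrite !mem_incseqs1 => /and3P[/eqP sm -> m_le].
rewrite sm eqxx /= => /allPn[u u_m]; have le_un := allP m_le u u_m.
rewrite -ltnNge => lt_u; have {lt_u le_un} eq_u : u = n by lia.
rewrite eq_u in u_m; have lt_l : (index n m < r)%N by rewrite -sm index_mem.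
(* The column of the entry n is zero. *)
rewrite -det_tr (expand_det_row _ (Ordinal lt_l)) big1 ?mulr0 // => j _.
rewrite !mxE /= nth_index //; have := psiQ (lift i j).
by rewrite eq_sym (negbTE (neq_lift _ _)) => ->; rewrite mul0r.
Qed.

(** * Acyclicity of a single block *)

Section BlockAcyclic.

Variables (F : fieldType) (r c d : nat) (z : F) (x : seq nat -> F).
Hypotheses (z_prim : r.-primitive_root z) (lt_cd : (c < d)%N).
Hypothesis x_selected : forall t, t \in incseqs 1 (r * d) r ->
  selected r t != c -> x t = 0.
Hypothesis x_cycle : forall m, m \in incseqs 1 (r * d).-1 r.-1 ->
  boundary (r * d) r x m = 0.

Let r_gt0 : (0 < r)%N := prim_order_gt0 z_prim.

Lemma pairing_weight (psi : 'I_r -> nat -> F) (zeta : F) :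
  zeta ^+ r = 1 ->
  (\sum_(t <- incseqs 1 (r * d) r)
     (x t * \det (minor_mx psi t)) *: 'X^(excess r c t)).[zeta] =
  pairing (r * d) x (fun i u => zeta ^+ weight r c u * psi i u).
Proof.
move=> zeta_r; rewrite horner_sum /pairing big_seq [RHS]big_seq.
apply: eq_bigr => t t_n; rewrite hornerZ hornerXn.
have [sel_t|/x_selected ->//] := eqVneq (selected r t) c;
  last by rewrite !mul0r.
rewrite -(expr_weight r_gt0 zeta_r t_n sel_t) det_minor_scale.
have /eqP st : size t == r by move: t_n; rewrite mem_incseqs => /andP[].
by rewrite prod_expr_weight // [in RHS]mulrCA mulrC.
Qed.

Lemma pairing_characters (B : {set 'I_r}) (psi : 'I_r -> nat -> F)
    (a : 'I_r -> nat) :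
    (forall (i : 'I_r) (phi : 'I_r -> nat -> F), i \in B ->
       adapted c (B :\ i) phi -> pairing (r * d) x phi = 0) ->
    adapted c B psi -> {in B, forall i, psi i = character r c (z ^+ a i)} ->
  pairing (r * d) x psi = 0.
Proof.
move=> IH psiB psi_char.
(* Two equal characters give two equal rows; otherwise the roots found below are distinct. *)
have [inj_a|] := boolP [forall i in B, forall j in B,
    (z ^+ a i == z ^+ a j) ==> (i == j)]; last first.
  rewrite negb_forall => /existsP[i]; rewrite negb_imply => /andP[iB].
  rewrite negb_forall => /existsP[j]; rewrite negb_imply => /andP[jB].
  rewrite negb_imply => /andP[/eqP eq_a neq_ij].
  by apply: (@pairing_alternate _ _ _ _ _ i j) => // u;
    rewrite !psi_char // eq_a.
pose p := \sum_(t <- incseqs 1 (r * d) r)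
  (x t * \det (minor_mx psi t)) *: 'X^(excess r c t).
have zX k : (z ^+ k) ^+ r = 1 by rewrite exprAC (prim_expr_order z_prim) expr1n.
have p_root i : i \in B -> root p (z ^+ a i)^-1.
  move=> iB; have zeta_r : ((z ^+ a i)^-1) ^+ r = 1 by rewrite exprVn zX invr1.
  have z_neq0 : z ^+ a i != 0 := unity_neq0 r_gt0 (zX _).
  apply/rootP; rewrite (pairing_weight _ zeta_r).
  pose phi (j : 'I_r) u := (z ^+ a i)^-1 ^+ weight r c u * psi j u.
  rewrite -/phi; have [kappa kappaE] := pairing_slot (r * d) x phi i.
  (* On the block the weight is the identity, so the twist cancels the character. *)
  have phi_i u : phi i u = (block r c u)%:R.
    rewrite /phi psi_char // /character; case: ifP => [u_block|_];
      last by rewrite mulr0.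
    have -> : weight r c u = u by move: u_block; rewrite /block /weight; lia.
    by rewrite -exprMn mulVf ?expr1n.
  have outside0 : pairing (r * d) x (slot phi i (fun u => (~~ block r c u)%:R))
    = 0.
    apply: (IH i) => // j u; rewrite /slot in_setD1.
    case: (eqVneq j i) => _ /=; first by case: (block r c u).
    by move=> neq_u; rewrite /phi psiB ?mulr0.
  have const0 : pairing (r * d) x (slot phi i (fun=> 1)) = 0.
    by apply: (pairing_cycle (i := i)) => //; rewrite /slot eqxx.
  transitivity (pairing (r * d) x (slot phi i (fun=> 1)) -
      pairing (r * d) x (slot phi i (fun u => (~~ block r c u)%:R))).
    rewrite -{1}(slot_id phi i) !kappaE -sumrB; apply: eq_bigr => u _.
    by rewrite phi_i -mulrBl; case: (block r c u); rewrite ?subr0 ?subrr.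
  by rewrite const0 outside0 subr0.
have p0 : p = 0.
  apply: (@roots_geq_poly_eq0 _ _ [seq (z ^+ a i)^-1 | i <- enum B]).
  - by apply/allP => _ /mapP[i iB ->]; apply: p_root; rewrite -mem_enum.
  - rewrite map_inj_in_uniq ?enum_uniq // => i j; rewrite !mem_enum => iB jB.
    move=> /invr_inj eq_a; apply/eqP; move/forall_inP: inj_a => /(_ i iB).
    by move=> /forall_inP/(_ j jB)/implyP; apply; apply/eqP.
  (* Each surviving t has exactly #|B| entries in the block, so its exponent is below #|B|. For
     empty B nothing survives, which starts the induction. *)
  rewrite size_map -cardE; apply: (leq_trans (size_sum _ _ _)).
  rewrite big_seq; elim/big_ind: _ => // [u v|t t_n];
    first by rewrite geq_max => -> ->.
  have [sel_t|/(x_selected t_n) ->] := eqVneq (selected r t) c; last first.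
    by rewrite mul0r scale0r size_poly0.
  have [->|det_t] := eqVneq (\det (minor_mx psi t)) 0.
    by rewrite mulr0 scale0r size_poly0.
  apply: leq_trans (size_scale_leq _ _) _; rewrite size_polyXn.
  have [_] := selected_excess r_gt0 t_n sel_t.
  by rewrite (adapted_card psiB) //; move: t_n;
    rewrite mem_incseqs => /andP[/eqP].
(* At zeta = 1 the twist is trivial and the polynomial gives the original pairing. *)
have := pairing_weight psi (expr1n _ r); rewrite -/p p0 horner0 => ->.
by congr pairing; apply: funext => i; apply: funext => u; rewrite expr1n mul1r.
Qed.

Lemma pairing_adapted (B : {set 'I_r}) psi :
  adapted c B psi -> pairing (r * d) x psi = 0.
Proof.
have [N] := ubnP #|B|; elim: N B psi => // N IH B psi lt_BN psiB.
have IHB (i : 'I_r) (phi : 'I_r -> nat -> F) : i \in B ->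
    adapted c (B :\ i) phi -> pairing (r * d) x phi = 0.
  by move=> iB; apply: IH; move: lt_BN; rewrite (cardsD1 i) iB.
apply: (@slotwise _ _ (fun phi => pairing (r * d) x phi = 0)
  (fun i f => forall u, block r c u != (i \in B) -> f u = 0)
  (fun i f => if i \in B then exists k, f = character r c (z ^+ k)
              else forall u, block r c u != (i \in B) -> f u = 0)) => //.
- move=> i f; case: (i \in B) => // -[k ->] u.
  by rewrite /character eqb_id => /negbTE ->.
- move=> {psiB} {}psi i psiB; have psi_i := psiB i.
  have [kappa kappaE] := pairing_slot (r * d) x psi i.
  rewrite -{2}(slot_id psi i); case: (i \in B) psi_i => psi_i Z; last exact: Z.
  rewrite kappaE; apply: (characters_span z_prim lt_cd) => [k|u u_block].
    by rewrite -kappaE Z //; exists k.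
  by apply: psi_i; rewrite eqb_id.
move=> {psiB} {}psi psiQ.
have [a aP] : exists a : 'I_r -> nat,
    {in B, forall i, psi i = character r c (z ^+ a i)}.
  have ex_a (i : 'I_r) : exists k, i \in B -> psi i = character r c (z ^+ k).
    by have := psiQ i; case: (i \in B) => [[k ->]|_]; [exists k | exists 0%N].
  by exists (fun i => sval (cid (ex_a i))) => i iB;
    apply: (svalP (cid (ex_a i))).
apply: (pairing_characters IHB _ aP) => i u.
have := psiQ i; case: (boolP (i \in B)) => [iB _|_]; last exact.
by rewrite (aP i iB) /character eqb_id => /negbTE ->.
Qed.

Lemma block_acyclic t : t \in incseqs 1 (r * d) r -> x t = 0.
Proof.
move=> t_n; rewrite -(pairing_delta x t_n).
apply: (pairing_adapted (B := [set i : 'I_r | block r c (nth 0%N t i)])) => i u.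
by rewrite inE; case: (eqVneq u (nth 0%N t i)) => [->|//]; rewrite eqxx.
Qed.

End BlockAcyclic.

(** * Kernel vectors of the matrix as solutions of the equations *)

Section DetS.

Variables (k : fieldType) (V : vectType k).

Lemma at_idx_notin n r (v : {ffun idx n r -> V}) t :
  t \notin incseqs 1 n r -> at_idx v t = 0.
Proof. by move=> t_n; rewrite /at_idx insubN. Qed.

Lemma equation_expand n r (v : {ffun idx n r -> V}) lambda m :
  equation v lambda m =
  \sum_(t <- incseqs 1 n r) lambda t *: equation v (fun s => (s == t)%:R) m.
Proof.
under eq_bigr do rewrite /equation scaler_sumr.
rewrite exchange_big; apply: eq_bigr => j _.
under eq_bigr do rewrite scaler_sumr.
rewrite exchange_big; apply: eq_bigr => s _ /=.
move: (take j m ++ s :: drop j m) => t.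
have [t_n|/(at_idx_notin v) ->] := boolP (t \in incseqs 1 n r); last first.
  by rewrite scaler0 big1 // => t' _; rewrite !scaler0.
rewrite (bigD1_seq t) ?incseqs_uniq //= eqxx mulr1 scalerA mulrC.
rewrite big1 ?addr0 // => t' /negbTE neq_t.
by rewrite eq_sym neq_t mulr0 scale0r scaler0.
Qed.

Variables (d : nat) (e : d.-tuple V) (r : nat).

Lemma matA_col (v : {ffun idx (r * d) r -> V}) lambda p : (0 < r)%N ->
  (matA e v *m \col_q lambda (nth [::] (incseqs 1 (r * d) r) q)) p 0 =
  coord e (Ordinal (ltn_mod_ord p))
    (equation v lambda (nth [::] (incseqs 1 (r * d).-1 r.-1) (p %/ d))).
Proof.
move=> r_gt0; rewrite mxE equation_expand linear_sum (big_nth [::]).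
rewrite size_cols // big_mkord; apply: eq_bigr => q _.
by rewrite linearZ !mxE mulrC.
Qed.

Lemma det_matA_eq0 (v : {ffun idx (r * d) r -> V}) : (0 < r)%N ->
  \det (matA e v) = 0 <->
  exists2 lambda, exists2 t, t \in incseqs 1 (r * d) r & lambda t != 0 &
    forall m c, m \in incseqs 1 (r * d).-1 r.-1 ->
      coord e c (equation v lambda m) = 0.
Proof.
move=> r_gt0; have cols := size_cols d r_gt0.
rewrite -det_tr; split=> [/eqP/det0P[w w_neq0 wA]|[lambda [t t_n lambda_t]
  eqs]].
  pose lambda t := if insub (index t (incseqs 1 (r * d) r)) is Some q
                   then w 0 q else 0.
  have lambdaE (q : 'I_(d * 'C((r * d).-1, r.-1))) :
      lambda (nth [::] (incseqs 1 (r * d) r) q) = w 0 q.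
    by rewrite /lambda index_uniq ?incseqs_uniq ?cols // valK.
  exists lambda.
    have [q wq] : exists q, w 0 q != 0 by apply/rV0Pn.
    exists (nth [::] (incseqs 1 (r * d) r) q); last by rewrite lambdaE.
    by rewrite mem_nth ?cols.
  move=> m c m_n; pose l := index m (incseqs 1 (r * d).-1 r.-1).
  have lt_l : (l < 'C((r * d).-1, r.-1))%N.
    by rewrite -(size_incseqs 1) index_mem.
  (* Row l * d + c holds coordinate c of the l-th equation. *)
  have lt_p : (l * d + c < d * 'C((r * d).-1, r.-1))%N.
    by have := ltn_ord c; rewrite mulnC; nia.
  have d_gt0 : (0 < d)%N by apply: leq_ltn_trans (ltn_ord c).
  have := matA_col v lambda (Ordinal lt_p) r_gt0.
  have -> : \col_q lambda (nth [::] (incseqs 1 (r * d) r) q) = w^T.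
    by apply/colP => q; rewrite !mxE lambdaE.
  rewrite -[matA e v]trmxK -trmx_mul wA !mxE /=.
  rewrite divnMDl // divn_small // addn0 nth_index // => ->.
  by congr (coord e _ _); apply: val_inj; rewrite /= modnMDl modn_small.
apply/eqP/det0P; exists (\row_q lambda (nth [::] (incseqs 1 (r * d) r) q)).
  have lt_q : (index t (incseqs 1 (r * d) r) < d * 'C((r * d).-1, r.-1))%N.
    by rewrite -cols index_mem.
  by apply/rV0Pn; exists (Ordinal lt_q); rewrite mxE /= nth_index.
apply: trmx_inj; rewrite trmx_mul trmxK trmx0; apply/colP => p.
transitivity (coord e (Ordinal (ltn_mod_ord p))
  (equation v lambda (nth [::] (incseqs 1 (r * d).-1 r.-1) (p %/ d)))).
  by rewrite -matA_col //; congr ((_ *m _) _ _); apply/colP => q; rewrite !mxE.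
rewrite [RHS]mxE; apply: eqs.
have d_gt0 : (0 < d)%N := leq_ltn_trans (leq0n _) (ltn_mod_ord p).
apply: mem_nth; rewrite size_incseqs.
by rewrite (ltn_divLR _ _ d_gt0) [X in (_ < X)%N]mulnC; apply: ltn_ord.
Qed.

(* The sign [(-1)^(s-1+j)] of the equations differs from the sign [(-1)^j] of *)
(* the simplicial boundary by [(-1)^(sum t)] and [- (-1)^(sum m)].            *)
Lemma coord_equation n (v : {ffun idx n r -> V}) lambda m c :
  coord e c (equation v lambda m) =
  - (-1) ^+ sumn m * boundary n r
      (fun t => (-1) ^+ sumn t * (lambda t * coord e c (at_idx v t))) m.
Proof.
rewrite /equation linear_sum /boundary mulr_sumr; apply: eq_bigr => j _.
rewrite linear_sum mulr_sumr big_seq [RHS]big_seq; apply: eq_bigr => s.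
rewrite mem_index_iota -/(insert j s m) linearZ sumn_insert /=.
case: s => [//|s] _; rewrite /= exprD addSn exprS exprD.
have sign2 : (-1) ^+ sumn m * (-1) ^+ sumn m = 1 :> k by rewrite -expr2
  sqrr_sign.
move: (coord _ _ _) (lambda _) ((-1) ^+ s) ((-1) ^+ j) => C L S J.
transitivity (((-1) ^+ sumn m * (-1) ^+ sumn m) * (S * J * L * C)).
  by rewrite sign2 mul1r.
ring.
Qed.

End DetS.

(** * The tensor E and the passage to characteristic zero *)

Section TensorE.

Variables (k : fieldType) (V : vectType k) (d : nat) (e : d.-tuple V).
Variables (r : nat) (r_gt0 : (0 < r)%N).
Hypothesis e_basis : basis_of {:V} e.

Definition tensorE_vectors : {ffun idx (r * d) r -> V} :=
  [ffun i => e`_(selected r (val i))].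

Lemma selected_lt t : t \in incseqs 1 (r * d) r -> (selected r t < d)%N.
Proof.
move=> t_n; have := incseqs_nth t_n (ltn_pmod (sumn t) r_gt0).
by rewrite /selected ltn_divLR // mulnC; lia.
Qed.

Lemma coord_tensorE t (c : 'I_d) : t \in incseqs 1 (r * d) r ->
  coord e c (at_idx tensorE_vectors t) = (selected r t == c)%:R.
Proof.
move=> t_n; rewrite /at_idx insubT ffunE /=.
have := coord_free (Ordinal (selected_lt t_n)) c (basis_free e_basis).
by rewrite /= => ->; rewrite -val_eqE.
Qed.

Lemma det_tensorE_prim (z : k) :
  r.-primitive_root z -> \det (matA e tensorE_vectors) != 0.
Proof.
move=> z_prim; apply/eqP => /(det_matA_eq0 e _ r_gt0)[lambda [t t_n lambda_t]
  eqs].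
pose c := Ordinal (selected_lt t_n).
pose x u := (-1) ^+ sumn u *
  (lambda u * coord e c (at_idx tensorE_vectors u)).
have x_selected u : u \in incseqs 1 (r * d) r -> selected r u != c -> x u = 0.
  by move=> u_n /negbTE neq_c; rewrite /x coord_tensorE // neq_c !mulr0.
have x_cycle m : m \in incseqs 1 (r * d).-1 r.-1 -> boundary (r * d) r x m = 0.
  move=> /(eqs m c); rewrite coord_equation => /eqP.
  by rewrite mulf_eq0 oppr_eq0 signr_eq0 => /eqP.
move/eqP: lambda_t; apply; apply/eqP.
have /eqP := block_acyclic z_prim (ltn_ord c) x_selected x_cycle t_n.
by rewrite /x coord_tensorE // eqxx mulr1 mulf_eq0 signr_eq0.
Qed.

(** Coordinates of the chosen basis vectors are 0 or 1, so one integer matrix, depending only on d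
    and r, serves all fields. *)
Definition int_matA : 'M[int]_(d * 'C((r * d).-1, r.-1)) :=
  \matrix_(p, q)
    let m := nth [::] (incseqs 1 (r * d).-1 r.-1) (p %/ d)%N in
    let t := nth [::] (incseqs 1 (r * d) r) q in
    (\sum_(0 <= j < r)
       \sum_((nth 0%N (0%N :: m) j).+1 <= s < nth (r * d).+1 m j)
         (if take j m ++ s :: drop j m == t then (-1) ^+ (s.-1 + j) else 0))
      * (selected r t == p %% d)%N%:R.

Lemma matA_tensorE : matA e tensorE_vectors = map_mx intr int_matA.
Proof.
apply/matrixP => p q; rewrite matAE !mxE rmorphM rmorph_nat coord_tensorE;
  last first.
  by rewrite mem_nth ?size_cols.
congr (_ * _); rewrite rmorph_sum; apply: eq_bigr => j _.
rewrite rmorph_sum; apply: eq_bigr => s _.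
by case: eqP => _; rewrite ?rmorph0 ?rmorph_sign.
Qed.

End TensorE.

(** The integer determinant is nonzero because its image in [algC], where primitive r-th roots of
    unity exist, is nonzero. *)
Lemma det_int_matA_neq0 r d : (0 < r)%N -> \det (int_matA d r) != 0.
Proof.
move=> r_gt0; have [z z_prim] := C_prim_root_exists r_gt0.
have [e e_basis] : exists e : d.-tuple 'rV[algC]_d, basis_of {:'rV[algC]_d} e.
  have dimV : \dim {:'rV[algC]_d} = d by rewrite dimvf dim_matrix mul1r.
  have : exists e : (\dim {:'rV[algC]_d}).-tuple 'rV[algC]_d,
      basis_of {:'rV[algC]_d} e by exists (vbasis {:'rV[algC]_d});
        apply: vbasisP.
  by rewrite dimV.
have := det_tensorE_prim r_gt0 e_basis z_prim.
by rewrite (matA_tensorE r_gt0 e_basis) det_map_mx intr_eq0.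
Qed.

Lemma det_tensorE_neq0 (k : fieldType) (V : vectType k) d (e : d.-tuple V) r :
    [pchar k] =i pred0 -> basis_of {:V} e -> (0 < r)%N ->
  detS e (tensorE e r) != 0.
Proof.
move=> /pcharf0P char_k e_basis r_gt0; rewrite detS_pure //.
rewrite -/(tensorE_vectors e r) (matA_tensorE r_gt0 e_basis) det_map_mx.
have := det_int_matA_neq0 d r_gt0; move: (\det _) => [] N.
  by rewrite /= -pmulrn char_k.
by rewrite NegzE => _; rewrite rmorphN oppr_eq0 /= -pmulrn char_k.
Qed.

(** * Vanishing on the relations and the dimension bound *)

Section Relations.

Variables (k : fieldType) (V : vectType k).

Definition face_chain r (X t : seq nat) : k :=
  \sum_(j < r.+1) (-1) ^+ j * (t == face j X)%:R.

(** All other faces contain the first entry of X, so nothing cancels; this makes the kernel vector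
    of [det_matA_relation] nonzero. *)
Lemma face_chain_head n r X : X \in incseqs 1 n r.+1 ->
  face_chain r X (face 0 X) = 1.
Proof.
move=> X_n; have := X_n; rewrite mem_incseqs => /and3P[/eqP sX X_lt _].
have uniq_X : uniq X := sorted_uniq ltn_trans ltnn X_lt.
rewrite /face_chain big_ord_recl eqxx mulr1 big1 ?addr0 // => j _.
case: eqP => [eq_f|_]; last by rewrite mulr0.
case: X {X_n X_lt} sX uniq_X eq_f => //= a X _ /andP[aX _] eq_f.
by move: aX; rewrite /face /= drop0 in eq_f *; rewrite eq_f mem_head.
Qed.

Lemma pairing_face_chain n r X (psi : 'I_r -> nat -> k) :
    X \in incseqs 1 n r.+1 ->
  pairing n (face_chain r X) psi =
  \det (minor_mx (fun i : 'I_r.+1 =>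
    if unlift ord0 i is Some i' then psi i' else fun=> 1) X).
Proof.
move=> X_n; have := X_n; rewrite mem_incseqs => /and3P[/eqP sX _ _].
rewrite /pairing /face_chain; under eq_bigr do rewrite mulr_suml.
rewrite exchange_big (expand_det_row _ ord0); apply: eq_bigr => j _ /=.
rewrite mxE unlift_none mul1r /cofactor add0n.
have f_n := face_incseqs X_n (ltn_ord j).
rewrite (bigD1_seq (face j X)) ?incseqs_uniq //= eqxx mulr1.
rewrite big1 ?addr0 => [|t /negbTE ->]; last by rewrite mulr0 mul0r.
congr (_ * \det _); apply/matrixP => i l; rewrite !mxE liftK.
by rewrite nth_face // sX ltnW.
Qed.

(** Pairing with the constant 1 and the point masses of m computes the boundary at m;
    [pairing_face_chain] adds a second row of ones, so the determinant vanishes. *)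
Lemma face_chain_cycle n r X m : (0 < r)%N ->
  X \in incseqs 1 n r.+1 -> m \in incseqs 1 n r.-1 ->
  boundary n r (face_chain r X) m = 0.
Proof.
case: r => // r _ X_n m_n.
pose psi (i : 'I_r.+1) : nat -> k :=
  if unlift ord0 i is Some i' then fun u => (u == nth 0%N m i')%:R else fun=> 1.
have := pairing_const_slot n (face_chain r.+1 X) (psi := psi) (i := ord0).
rewrite /psi unlift_none => /(_ erefl).
rewrite expr0 mul1r.
under [in RHS]eq_bigr => t _.
  rewrite (_ : minor_mx _ _ =
    minor_mx (fun (j : 'I_r) u => (u == nth 0%N m j)%:R) t); last first.
    by apply/matrixP => i l; rewrite !mxE liftK.
  over.
rewrite [RHS](pairing_delta (boundary n r.+1 (face_chain r.+1 X)) m_n) => <-.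
rewrite pairing_face_chain //.
apply: (determinant_alternate (neq_lift ord0 ord0)) => l.
by rewrite !mxE unlift_none liftK unlift_none.
Qed.

(** As v takes a single value w on the faces of X, the signed chain [face_chain r X] makes every
    equation a multiple of w by a boundary of a boundary. *)
Lemma det_matA_relation d (e : d.-tuple V) r (v : {ffun idx (r * d) r -> V}) X :
    (0 < r)%N -> X \in incseqs 1 (r * d) r.+1 ->
    (forall i j : idx (r * d) r,
       {subset val i <= X} -> {subset val j <= X} -> v i = v j) ->
  \det (matA e v) = 0.
Proof.
move=> r_gt0 X_n v_const; apply/(det_matA_eq0 e v r_gt0).
pose w := at_idx v (face 0 X).
have f_n j : (j <= r)%N -> face j X \in incseqs 1 (r * d) r by apply:
  face_incseqs.
have v_face t : face_chain r X t != 0 -> at_idx v t = w.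
  move=> t_neq0; have /existsP[j /eqP ->] : [exists j : 'I_r.+1, t == face j X].
    apply: contraNT t_neq0; rewrite negb_exists => /forallP t_neq.
    by apply/eqP/big1 => j _; rewrite (negbTE (t_neq j)) mulr0.
  have sub_face i : {subset face i X <= X}.
    move=> u; rewrite mem_cat => /orP[/mem_take //|/mem_drop //].
  rewrite /w /at_idx; case: insubP => [i _ val_i|];
    last by rewrite f_n // -ltnS.
  case: insubP => [i' _ val_i'|]; last by rewrite f_n.
  by apply: v_const; rewrite ?val_i ?val_i'; apply: sub_face.
exists (fun t => (-1) ^+ sumn t * face_chain r X t).
  exists (face 0 X); first exact: f_n.
  by rewrite (face_chain_head X_n) mulr1 signr_eq0.
move=> m c m_n; rewrite coord_equation.
have -> : (fun t => (-1) ^+ sumn t * ((-1) ^+ sumn t * face_chain r X t *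
    coord e c (at_idx v t))) = (fun t => face_chain r X t * coord e c w).
  apply: funext => t; rewrite !mulrA -expr2 sqrr_sign mul1r.
  by have [->|/v_face ->] := eqVneq (face_chain r X t) 0; rewrite ?mul0r.
apply/eqP; rewrite mulf_eq0 oppr_eq0 signr_eq0 /=; apply/eqP.
rewrite [LHS](_ : _ = boundary (r * d) r (face_chain r X) m * coord e c w).
  rewrite face_chain_cycle ?mul0r //.
  move: m_n; rewrite !mem_incseqs1 => /and3P[-> -> /= /allP m_le].
  by apply/allP => u /m_le; lia.
rewrite /boundary mulr_suml; apply: eq_bigr => j _; rewrite mulr_suml.
by apply: eq_bigr => s _; rewrite mulrA.
Qed.

(** The kernel of [detS] contains the span of the relations; were the quotient zero, this span would
    be everything and [detS] would vanish. *)
Lemma dim_LambdaS_gt0 d (e : d.-tuple V) r : (0 < r)%N ->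
  (exists t, detS e (r := r) t != 0) -> (0 < \dim {:LambdaS V r (r * d)})%N.
Proof.
move=> r_gt0 [t]; apply: contra_neqT; rewrite -eqn0Ngt dimv_eq0 => /eqP full0.
have t_span : t \in spanset (@lambda_relation k V r (r * d)).
  rewrite -[t]subr0 -vproj_eq; apply/eqP.
  have all0 (q : LambdaS V r (r * d)) : q = 0.
    by apply/eqP; rewrite -memv0 -full0 memvf.
  by rewrite [LHS]all0 [RHS]all0.
suff : t \in lker (linfun (detS e (r := r))) by rewrite memv_ker lfunE => /eqP.
have /spansetP/subvP : forall x, @lambda_relation k V r (r * d) x ->
    x \in lker (linfun (detS e (r := r))); last exact.
move=> _ [v -> [X X_n v_const]].
by rewrite memv_ker lfunE /= detS_pure // (det_matA_relation e r_gt0 X_n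
  v_const).
Qed.

End Relations.

Theorem propositionA2 (k : fieldType) (char_k : [pchar k] =i pred0)
    (V : vectType k) (d : nat) (e : d.-tuple V) (e_basis : basis_of {:V} e)
    (r : nat)
    (r_d : [\/ r = 2%N /\ (2 <= d <= 10)%N,
               r = 3%N /\ (2 <= d <= 10)%N,
               r = 4%N /\ (2 <= d <= 9)%N |
               r = 5%N /\ (2 <= d <= 5)%N] \/
           [\/ r = 6%N /\ (2 <= d <= 3)%N,
               r = 7%N /\ d = 2%N |
               r = 8%N /\ d = 2%N]) :
  [/\ detS e (tensorE e r) != 0,
      exists t, detS e (r := r) t != 0 &
      (1 <= \dim {:LambdaS V r (r * d)})%N].
Proof.
have r_gt0 : (0 < r)%N by case: r_d => -[] [->].
have detE_neq0 := det_tensorE_neq0 char_k e_basis r_gt0.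
have ex_t : exists t, detS e (r := r) t != 0 by exists (tensorE e r).
by split=> //; apply: dim_LambdaS_gt0 ex_t.
Qed.
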